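(* For $k=3/2$ and every real $\mu\ge0$, $$\mu^{2k-2}\sum_{m\in\mathbb{Z}^2_0}\frac{1}{\bigl(|m|^2+\mu^2\bigr)^k}<\frac{\pi}{k-1}.$$
   Context: $\mathbb{Z}^2_0=\mathbb{Z}^2\setminus\{0\}$ and $|m|^2=m_1^2+m_2^2$ for $m=(m_1,m_2)$. *)

(* Defs.v *)
From HB Require Import structures.
From mathcomp Require Export all_boot all_order all_algebra.
From mathcomp Require Export all_classical all_reals all_analysis.

Set Implicit Arguments.
Unset Strict Implicit.
Unset Printing Implicit Defensive.

Import Order.TTheory GRing.Theory Num.Theory.

Local Open Scope classical_set_scope.
Local Open Scope ring_scope.

Definition Z2_0 : set (int * int) := [set m | m != (0, 0)].

Definition normsq (m : int * int) : int := m.1 ^+ 2 + m.2 ^+ 2.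

(* The terms are nonnegative, so the unordered sum [esum], a supremum of finite
   partial sums with values in the extended reals, is the sum of the series. *)
Definition lattice_sum (R : realType) (k mu : R) : \bar R :=
  \esum_(m in Z2_0) ((((normsq m)%:~R + mu ^+ 2) `^ k)^-1)%:E.

(* Main.v *)
Require Import Defs.
From mathcomp Require Import finmap zify ring lra.

(** Why the inequality holds.  Write S(mu) for the sum over the nonzero lattice
    points of (|m|^2 + mu^2)^(-3/2); the claim is mu S(mu) < 2 pi, where 2 pi is
    the integral over the plane of mu (|y|^2 + mu^2)^(-3/2).  So a lattice sum
    deprived of its central term mu^(-2) has to be compared with the integral, up
    to an error smaller than mu^(-2).

    The comparison is Jensen's inequality on unit cells.  On a unit interval
    centred at c the mean of y^2 is c^2 + 1/12, so for g convex
      g (b + c^2 + 1/12) <= integral of g (b + y^2) over the cell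
    ([cell_jensen]).  Evaluating the sum at b + 1/12 thus costs nothing but a
    shift of the parameter by 1/12 in each of the two coordinates.  Summing along
    a row with g t = t^(-3/2), and then over the rows with g t = 1/t, both
    integrals are elementary (their primitives are y / (b sqrt (b + y^2)) and an
    arctangent) and telescope, whence, with c^2 = mu^2 - 1/6,
      mu^(-3) + S(mu) <= 2 pi / c            ([shifted_lattice_sum_le]).
    The loss 2 pi mu / c - 2 pi is about (pi/6) mu^(-2), less than the mu^(-2)
    gained from the missing origin; [scaled_bound_lt] makes this precise for
    mu^2 >= 1/3.

    For mu^2 < 1/3 the factor mu is small and it suffices to bound S(mu) by
    S(0) <= 21/2, as (21/2) / sqrt 3 < 2 pi.  This uniform bound
    ([lattice_sum_le]) comes from the same row estimate away from the axis and
    from telescoping majorants; it also gives convergence.  The numerical facts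
    needed are 3.1 < pi <= 10/3. *)

Import Order.TTheory GRing.Theory Num.Theory numFieldNormedType.Exports.
Local Open Scope ring_scope.

(** * Telescoping bounds for sums over the integers *)

Lemma esum_telescope_le (R : realType) (f H : int -> R) (L U : R) :
    (forall n, 0 <= f n) -> (forall n, f n <= H (n + 1) - H n) ->
    (forall n, L <= H n <= U) ->
  (\esum_(n in [set: int]) (f n)%:E <= (U - L)%:E)%E.
Proof.
move=> f0 fH HLU; apply: ge_ereal_sup => _ [X [finX _] <-].
rewrite fsbig_finite//= sumEFin lee_fin.
(* All indices of the finite partial sum lie in the window [-N, N]. *)
pose N := (\max_(n <- fset_set X) `|n|)%N.
pose s : seq int := [seq i%:Z - N%:Z | i <- iota 0 (N.*2.+1)].
have Xs (n : int) : n \in fset_set X -> n \in s.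
  move=> nX; have nN : (`|n| <= N)%N by exact: leq_bigmax_seq.
  by apply/mapP; exists `|(n + N%:Z)%R|%N; [rewrite mem_iota|]; lia.
have us : uniq s by rewrite map_inj_uniq ?iota_uniq// => i j; lia.
apply: (@le_trans _ _ (\sum_(n <- s) f n)).
  rewrite [leRHS](bigID (mem (fset_set X : seq int)))/=.
  rewrite -[X in _ <= X + _]big_filter.
  rewrite [X in _ <= X + _](perm_big (fset_set X : seq int)).
    by rewrite lerDl sumr_ge0.
  apply: uniq_perm; rewrite ?filter_uniq ?fset_uniq//.
  move=> n; rewrite mem_filter.
  by apply/andP/idP => [[]//|nX]; split => //; exact: Xs.
rewrite big_map -[iota _ _]/(index_iota 0 N.*2.+1).
apply: (@le_trans _ _ (\sum_(0 <= i < N.*2.+1) (H (i.+1%:Z - N%:Z) - H (i%:Z - N%:Z)))).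
  apply: ler_sum => i _; rewrite (_ : i.+1%:Z - N%:Z = i%:Z - N%:Z + 1) ?fH//.
  by lia.
rewrite (telescope_sumr (fun i => H (i%:Z - N%:Z)))//.
by have /andP[_ ?] := HLU (N.*2.+1%:Z - N%:Z); have /andP[? _] := HLU (0%:Z - N%:Z); lra.
Qed.

(** A two-sided version of the previous bound for sums controlled by |n|: the
    majorant A telescopes once on each side of the origin. *)
Lemma esum_even_telescope_le (R : realType) (f : int -> R) (A : nat -> R) :
    (forall n, 0 <= f n) -> (forall n, 0 <= A n.+1) ->
    (forall n : int, n != 0 -> f n <= A `|n|%N - A `|n|.+1) ->
  (\esum_(n in [set: int]) (f n)%:E <= (f 0 + 2 * A 1%N)%:E)%E.
Proof.
move=> f0 A0 fA.
have A1 n : A n.+1 <= A 1%N.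
  elim: n => // n /(le_trans _); apply.
  by have := fA n.+1%:Z isT; have := f0 n.+1%:Z; rewrite /=; lra.
(* Gluing the two half-lines: H climbs by at most A 1 on n <= 0, jumps by f 0
   between 0 and 1, and climbs by at most A 1 again on n >= 1. *)
pose H (n : int) := match n with
  | Posz 0 => A 1%N | Posz n' => f 0 + 2 * A 1%N - A n' | Negz n' => A n'.+2 end.
rewrite -[f 0 + _]subr0; apply: (@esum_telescope_le _ _ H) => // -[[|n]|[|n]].
- by rewrite /=; lra.
- rewrite (_ : n.+1%:Z + 1 = n.+2%:Z) /=; last by lia.
  by have := fA n.+1%:Z isT; rewrite /=; lra.
- by have := fA (Negz 0) isT; rewrite /=; lra.
- rewrite (_ : Negz n.+1 + 1 = Negz n) /=; last by lia.
  by have := fA (Negz n.+1) isT; rewrite /=; lra.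
- by have := A0 0%N; have := f0 0; rewrite /=; lra.
- by have := A0 n; have := A1 n; have := f0 0; rewrite /=; lra.
- by have := A0 1%N; have := A1 1%N; have := f0 0; have := A0 0%N; rewrite /=; lra.
- by have := A0 n.+2; have := A1 n.+2; have := f0 0; have := A0 0%N; rewrite /=; lra.
Qed.

(** * Jensen's inequality on a unit cell *)

Lemma nonneg_derive_le (R : realType) (f df : R -> R) (a b : R) :
    a <= b -> (forall x : R, is_derive x 1 f (df x)) ->
    (forall x, a <= x <= b -> 0 <= df x) -> f a <= f b.
Proof.
move=> ab fdf df0.
have cf : {within `[a, b], continuous f}%classic.
  by apply: derivable_within_continuous => x _; apply: ex_derive.
have [x] := MVT_segment ab (fun x _ => fdf x) cf.
rewrite in_itv /= => xab fE; rewrite -subr_ge0 fE.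
by rewrite mulr_ge0 ?subr_ge0 ?df0.
Qed.

(** Jensen's inequality for g on the cell centred at c, in terms of a primitive
    H of y |-> g (b + y^2).  Convexity enters only as a supporting line of slope s
    at T, the mean of b + y^2 over the cell; integrating the supporting line over
    the cell gives exactly g T. *)
Lemma cell_jensen (R : realType) (g H : R -> R) (b c s : R) :
    let T := b + c ^+ 2 + 12^-1 in
    (forall y : R, is_derive y 1 H (g (b + y ^+ 2))) ->
    (forall y, g T + s * (b + y ^+ 2 - T) <= g (b + y ^+ 2)) ->
  g T <= H (c + 2^-1) - H (c - 2^-1).
Proof.
move=> T dH gT.
pose K y := H y - (g T * y + s * ((b - T) * y + 3^-1 * y ^+ 3)).
suff : K (c - 2^-1) <= K (c + 2^-1).
  rewrite /K -subr_ge0; set e := (X in 0 <= X).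
  suff -> : e = H (c + 2^-1) - H (c - 2^-1) - g T by rewrite subr_ge0.
  by rewrite /e /T; field.
pose dK y := g (b + y ^+ 2) - (g T + s * (b + y ^+ 2 - T)).
apply: (@nonneg_derive_le _ _ dK); [lra| |by move=> y _; rewrite subr_ge0].
move=> y; rewrite /K /dK; apply: is_deriveB.
by apply: is_derive_eq; rewrite /GRing.scale/=; field.
Qed.

(** * Sums along a row *)

Lemma powR_3half (R : realType) (x : R) : 0 < x -> x `^ (3 / 2) = Num.sqrt x ^+ 3.
Proof.
move=> x0; rewrite mulrC powRrM powR12_sqrt ?ltW// -powR_mulrn ?sqrtr_ge0//.
Qed.

(** The supporting line of the convex function t^(-3/2), with p and q the square
    roots of the two abscissae.  The difference of the sides is (p - q)^2
    times a quotient of polynomials with nonnegative coefficients. *)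
Lemma inv_cube_tangent (R : realFieldType) (p q : R) : 0 < p -> 0 < q ->
  (q ^+ 3)^-1 - 3 / 2 * (q ^+ 5)^-1 * (p ^+ 2 - q ^+ 2) <= (p ^+ 3)^-1.
Proof.
move=> p0 q0; rewrite -subr_ge0.
have -> : (p ^+ 3)^-1 - ((q ^+ 3)^-1 - 3 / 2 * (q ^+ 5)^-1 * (p ^+ 2 - q ^+ 2)) =
    (p - q) ^+ 2 * (3 * p ^+ 3 + 6 * p ^+ 2 * q + 4 * p * q ^+ 2 + 2 * q ^+ 3)
    / (2 * p ^+ 3 * q ^+ 5).
  by field; rewrite !gt_eqF.
have [p1 q1] := (ltW p0, ltW q0).
by rewrite !(sqr_ge0, exprn_ge0, divr_ge0, mulr_ge0, addr_ge0).
Qed.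

Section row.
Variables (R : realType) (b : R).
Hypothesis b0 : 0 < b.
Let H (y : R) := y / (b * Num.sqrt (b + y ^+ 2)).

Let s0 y : 0 < b + y ^+ 2. Proof. by rewrite ltr_wpDr ?sqr_ge0. Qed.

Let dH (y : R) : is_derive y 1 H (Num.sqrt (b + y ^+ 2) ^+ 3)^-1.
Proof.
have ds : is_derive y 1 (fun z : R => Num.sqrt (b + z ^+ 2))
    ((2 * Num.sqrt (b + y ^+ 2))^-1 * (2 * y)).
  apply: (@is_derive1_comp _ Num.sqrt (fun z => b + z ^+ 2)).
    exact: is_derive1_sqrt.
  by apply: is_derive_eq; rewrite /GRing.scale/=; ring.
have n0 : b * Num.sqrt (b + y ^+ 2) != 0 by rewrite mulf_neq0 ?gt_eqF ?sqrtr_gt0.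
apply: is_derive_eq.
have := sqr_sqrtr (ltW (s0 y)); have : Num.sqrt (b + y ^+ 2) != 0.
  by rewrite gt_eqF ?sqrtr_gt0.
move: (Num.sqrt _) => s sn sE; rewrite /GRing.scale/=.
have bE : b = s ^+ 2 - y ^+ 2 by rewrite sE addrK.
have : b != 0 by rewrite gt_eqF.
rewrite bE => bn.
field.
by rewrite sn bn.
Qed.

Let HB y : - b^-1 <= H y <= b^-1.
Proof.
have s0' : 0 < Num.sqrt (b + y ^+ 2) by rewrite sqrtr_gt0.
rewrite -ler_norml /H normrM normfV normrM (gtr0_norm b0) (gtr0_norm s0').
rewrite invfM mulrCA ler_piMr ?invr_ge0 ?(ltW b0)// ler_pdivrMr// mul1r.
by rewrite -sqrtr_sqr ler_wsqrtr// lerDr ltW.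
Qed.

Lemma row_sum_le : 
  (\esum_(n in [set: int]) (((n%:~R ^+ 2 + (b + 12^-1)) `^ (3 / 2))^-1)%:E
   <= (2 / b)%:E)%E.
Proof.
rewrite (_ : 2 / b = b^-1 - (- b^-1)); last by rewrite opprK; field; rewrite gt_eqF.
apply: (@esum_telescope_le _ _ (fun n => H (n%:~R - 2^-1))) => n.
- by rewrite invr_ge0 powR_ge0.
- have T0 : 0 < b + n%:~R ^+ 2 + 12^-1 by have := s0 n%:~R; lra.
  rewrite [_ + (b + _)](_ : _ = b + n%:~R ^+ 2 + 12^-1); last by ring.
  rewrite powR_3half// (_ : (n + 1)%:~R - 2^-1 = n%:~R + 2^-1 :> R); last first.
    by rewrite intrD; field.
  pose T := b + n%:~R ^+ 2 + 12^-1.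
  pose g t := (Num.sqrt t ^+ 3)^-1 : R.
  apply: (@cell_jensen _ g H b n%:~R (- (3 / 2 * (Num.sqrt T ^+ 5)^-1)) dH).
  move=> y.
  have := @inv_cube_tangent _ (Num.sqrt (b + y ^+ 2)) (Num.sqrt T).
  rewrite !sqrtr_gt0 => /(_ (s0 y) T0).
  by rewrite !sqr_sqrtr ?(ltW T0) ?(ltW (s0 y))// mulNr.
- exact: HB.
Qed.
End row.

(** * Sums over the rows, and the value of pi *)

Lemma inv_tangent (R : realFieldType) (x t : R) : 0 < x -> 0 < t ->
  t^-1 - (t ^+ 2)^-1 * (x - t) <= x^-1.
Proof.
move=> x0 t0; rewrite -subr_ge0.
have -> : x^-1 - (t^-1 - (t ^+ 2)^-1 * (x - t)) = (x - t) ^+ 2 / (x * t ^+ 2).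
  by field; rewrite !gt_eqF.
by have x1 := ltW x0; rewrite !(sqr_ge0, divr_ge0, mulr_ge0).
Qed.

Section column.
Variables (R : realType) (c : R).
Hypothesis c0 : 0 < c.
Let H (y : R) := atan (y / c) / c.

Let dH (y : R) : is_derive y 1 H (c ^+ 2 + y ^+ 2)^-1.
Proof.
have da : is_derive y 1 (fun z : R => atan (z / c)) ((1 + (y / c) ^+ 2)^-1 * c^-1).
  apply: (@is_derive1_comp _ atan (fun z => z / c)).
  by apply: is_derive_eq; rewrite /GRing.scale/=; ring.
apply: is_derive_eq; rewrite /GRing.scale/=.
field; rewrite !gt_eqF//= ?ltr_pwDl ?sqr_ge0 ?exprn_gt0//.
Qed.

Lemma inv_le_atanB (a : R) :
  (c ^+ 2 + a ^+ 2 + 12^-1)^-1 <= (atan ((a + 2^-1) / c) - atan ((a - 2^-1) / c)) / c.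
Proof.
rewrite mulrBl.
have c2 y : 0 < c ^+ 2 + y ^+ 2 by rewrite ltr_pwDl ?sqr_ge0 ?exprn_gt0.
have T0 : 0 < c ^+ 2 + a ^+ 2 + 12^-1 by have := c2 a; lra.
pose g (t : R) := t^-1.
apply: (@cell_jensen _ g H (c ^+ 2) a (- ((c ^+ 2 + a ^+ 2 + 12^-1) ^+ 2)^-1) dH).
by move=> y; rewrite mulNr; exact: inv_tangent.
Qed.

Lemma column_sum_le :
  (\esum_(m in [set: int]) (2 / (m%:~R ^+ 2 + (c ^+ 2 + 12^-1)))%:E
   <= (2 * pi / c)%:E)%E.
Proof.
rewrite (_ : 2 * pi / c = pi / c - (- (pi / c))); last by field; rewrite gt_eqF.
apply: (@esum_telescope_le _ _ (fun n => 2 * H (n%:~R - 2^-1))) => n.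
- by rewrite divr_ge0// addr_ge0 ?sqr_ge0// addr_ge0 ?sqr_ge0.
- have := inv_le_atanB n%:~R.
  rewrite (_ : (n + 1)%:~R - 2^-1 = n%:~R + 2^-1 :> R); last first.
    by rewrite intrD; field.
  rewrite -mulrBr /H -mulrBl [_ + (c ^+ 2 + _)](_ : _ = c ^+ 2 + n%:~R ^+ 2 + 12^-1).
    by move=> ?; rewrite ler_pM2l.
  by ring.
- set x := _ - _.
  have := atan_gtNpi2 (x / c); have := atan_ltpi2 (x / c).
  have ci : 0 < c^-1 by rewrite invr_gt0.
  rewrite /H; move: (atan _) => t h1 h2.
  by rewrite -mulNr mulrA !ler_pM2r//; apply/andP; split; lra.
Qed.
End column.

(** With c = 2, the two cells [0, 1] and [1, 2] bound atan 1 = pi / 4 from below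
    by 6/13 + 6/19, hence pi by 3.109; the single cell [0, 1] with c = 1 would only
    give pi >= 3. *)
Lemma pi_gt31 (R : realType) : 31 / 10 < pi :> R.
Proof.
have := @inv_le_atanB R 2 ltac:(by []) (1 / 2).
have := @inv_le_atanB R 2 ltac:(by []) (3 / 2).
have -> : (1 / 2 - 2^-1) / 2 = 0 :> R by field.
have -> : (1 / 2 + 2^-1) / 2 = 1 / 2 :> R by field.
have -> : (3 / 2 - 2^-1) / 2 = 1 / 2 :> R by field.
have -> : (3 / 2 + 2^-1) / 2 = 1 :> R by field.
have -> : (2 ^+ 2 + (1 / 2) ^+ 2 + 12^-1)^-1 = 3 / 13 :> R by field.
have -> : (2 ^+ 2 + (3 / 2) ^+ 2 + 12^-1)^-1 = 3 / 19 :> R by field.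
rewrite atan0 atan1; lra.
Qed.

(** From 1 / (1 + y^2) <= 1 - y^2 / 2 on [0, 1], whose right-hand side has
    integral 5/6. *)
Lemma pi_le_10_3 (R : realType) : pi <= 10 / 3 :> R.
Proof.
pose f (y : R) := (y - 6^-1 * y ^+ 3) - atan y.
pose df (y : R) := (1 - 2^-1 * y ^+ 2) - (1 + y ^+ 2)^-1.
have : f 0 <= f 1.
  apply: (@nonneg_derive_le _ f df) => // [y|y /andP[y0 y1]].
    by apply: is_deriveB; apply: is_derive_eq; rewrite /GRing.scale/=; field.
  have y2 : 0 <= 1 - y ^+ 2 by rewrite subr_ge0 expr_le1.
  have -> : df y = y ^+ 2 * (1 - y ^+ 2) / (2 * (1 + y ^+ 2)).
    by rewrite /df; field; rewrite gt_eqF// ltr_pwDl ?sqr_ge0.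
  by rewrite !(y2, sqr_ge0, divr_ge0, mulr_ge0, addr_ge0).
rewrite /f atan0 atan1 expr0n expr1n /=; lra.
Qed.

(** * Lattice sums *)

Lemma esum_rows_le (R : realType) (a : int -> int -> \bar R) (r : int -> R) :
    (forall m n, 0 <= a m n)%E ->
    (forall m, \esum_(n in [set: int]) a m n <= (r m)%:E)%E ->
  (\esum_(p in [set: int * int]) a p.1 p.2
    <= \esum_(m in [set: int]) (r m)%:E)%E.
Proof.
move=> a0 ar; rewrite (_ : [set: int * int] = [set: int] `*`` (fun=> [set: int]))%classic.
  by rewrite -esum_esum// le_esum.
by apply/seteqP; split.
Qed.

(** The two successive one-dimensional Jensen steps: each shifts the parameter by
    1/12, which accounts for the total shift 1/6. *)
Lemma shifted_lattice_sum_le (R : realType) (c mu : R) : 0 < c ->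
    mu ^+ 2 = c ^+ 2 + 6^-1 ->
  (\esum_(m in [set: int * int])
     ((((normsq m)%:~R + mu ^+ 2) `^ (3 / 2))^-1)%:E <= (2 * pi / c)%:E)%E.
Proof.
move=> c0 muE; apply: le_trans (@column_sum_le _ _ c0).
pose a (m n : int) := ((((normsq (m, n))%:~R + mu ^+ 2) `^ (3 / 2))^-1)%:E : \bar R.
rewrite (_ : \esum_(m in _) _ = \esum_(p in [set: int * int]) a p.1 p.2); last first.
  by apply: eq_esum => -[].
apply: esum_rows_le => [m n|m]; first by rewrite lee_fin invr_ge0 powR_ge0.
have b0 : 0 < m%:~R ^+ 2 + (c ^+ 2 + 12^-1) :> R.
  by rewrite ltr_wpDl ?sqr_ge0// ltr_pwDl ?exprn_gt0.
apply: le_trans (@row_sum_le _ _ b0).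
apply: le_esum => n _; rewrite /a /normsq /= intrD !rmorphXn /= muE.
rewrite (_ : _ + (c ^+ 2 + _) = n%:~R ^+ 2 + (m%:~R ^+ 2 + (c ^+ 2 + 12^-1) + 12^-1))//.
by field.
Qed.

Lemma lattice_sum_le_subr (R : realType) (c mu : R) : 0 < c -> 0 < mu ->
    mu ^+ 2 = c ^+ 2 + 6^-1 ->
  (lattice_sum (3 / 2) mu <= (2 * pi / c - (mu ^+ 3)^-1)%:E)%E.
Proof.
move=> c0 mu0 muE; rewrite EFinB leeBrDr//.
have F0 m : (0 <= ((((normsq m)%:~R + mu ^+ 2) `^ (3 / 2))^-1)%:E :> \bar R)%E.
  by rewrite lee_fin invr_ge0 powR_ge0.
apply: le_trans (@shifted_lattice_sum_le _ _ _ c0 muE).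
rewrite (esumID Z2_0) ?setTI//; apply: leeD => //.
rewrite (_ : ~` Z2_0 = [set (0, 0)])%classic; last first.
  apply/seteqP; split => [m /negP|_ ->]; last by [].
  by rewrite negbK => /eqP.
rewrite esum_set1// /normsq /= expr0n addr0 add0r powR_3half ?exprn_gt0//.
by rewrite sqrtr_sqr gtr0_norm.
Qed.

Lemma axis_sum_le (R : realType) :
  (\esum_(n in [set: int])
    (if n == 0 then 0 else ((n%:~R ^+ 2) `^ (3 / 2))^-1)%:E <= (5 / 2 : R)%:E)%E.
Proof.
(* A (n) - A (n + 1) = 4 n / (4 n^4 - (4/5) n^2 + 16/25), which is at least n^(-3)
   as soon as n^2 >= 4/5; the constant 4/5 is a convenient value just below the
   largest admissible one, 2 sqrt 2 - 2. *)
pose A (n : nat) : R := (2 * n%:R ^+ 2 - 2 * n%:R + 4 / 5)^-1.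
pose f (n : int) : R := if n == 0 then 0 else ((n%:~R ^+ 2) `^ (3 / 2))^-1.
rewrite (_ : 5 / 2 = f 0 + 2 * A 1%N); last by rewrite /f /A eqxx; field.
have D0 (x : R) : 0 < 2 * x ^+ 2 - 2 * x + 4 / 5.
  by have := sqr_ge0 (x - 2^-1); nra.
apply: esum_even_telescope_le => [n|n|n n0].
- by rewrite /f; case: ifP; rewrite ?invr_ge0 ?powR_ge0.
- by rewrite /A invr_ge0 ltW.
rewrite /f (negbTE n0) powR_3half ?exprn_even_gt0 ?intr_eq0// sqrtr_sqr.
rewrite -intr_norm -abszE -pmulrn /A -[(`|n|.+1)%N]addn1 natrD.
have : 1 <= `|n|%:R :> R by rewrite ler1n absz_gt0.
move: (`|n|%N%:R) => x x1.
rewrite -subr_ge0.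
have -> : (2 * x ^+ 2 - 2 * x + 4 / 5)^-1 - (2 * (x + 1) ^+ 2 - 2 * (x + 1) + 4 / 5)^-1
   - (x ^+ 3)^-1 = (4 / 5 * x ^+ 2 - 16 / 25) /
   (x ^+ 3 * (2 * x ^+ 2 - 2 * x + 4 / 5) * (2 * (x + 1) ^+ 2 - 2 * (x + 1) + 4 / 5)).
  field.
  have := D0 x; have := D0 (x + 1) => h1 h2.
  by rewrite !gt_eqF//; nra.
have x0 : 0 <= x by lra.
have h : 0 <= 4 / 5 * x ^+ 2 - 16 / 25 by nra.
by rewrite !(h, divr_ge0, mulr_ge0, exprn_ge0, ltW (D0 _)).
Qed.

(** The terms decrease in mu, so the case mu = 0 bounds all others.  There, the
    row at height m <> 0 contributes at most 2 / (m^2 - 1/12), in total at most 8,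
    and the axis m = 0 at most 5/2. *)
Lemma lattice_sum_le (R : realType) (mu : R) :
  (lattice_sum (3 / 2) mu <= (21 / 2)%:E)%E.
Proof.
pose a (m n : int) : R :=
  if (m, n) == (0, 0) then 0 else ((m%:~R ^+ 2 + n%:~R ^+ 2) `^ (3 / 2))^-1.
pose r (m : int) : R := if m == 0 then 5 / 2 else 2 / (m%:~R ^+ 2 - 12^-1).
have m1 (m : int) : m != 0 -> 1 <= m%:~R ^+ 2 :> R.
  by move=> m0; rewrite -rmorphXn /= ler1z -gtz0_ge1 exprn_even_gt0.
have a0 m n : (0 <= (a m n)%:E)%E.
  by rewrite lee_fin /a; case: ifP => // _; rewrite invr_ge0 powR_ge0.
have ar m : (\esum_(n in [set: int]) (a m n)%:E <= (r m)%:E)%E.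
  rewrite /r; case: eqP => [->|/eqP m0].
    apply: le_trans (@axis_sum_le R); apply: le_esum => n _.
    by rewrite /a xpair_eqE eqxx /= expr0n add0r.
  have b0 : 0 < m%:~R ^+ 2 - 12^-1 :> R by have := m1 m m0; lra.
  apply: le_trans (@row_sum_le _ _ b0); apply: le_esum => n _.
  by rewrite /a xpair_eqE (negbTE m0) /= subrK addrC.
have rE : (\esum_(m in [set: int]) (r m)%:E <= (21 / 2)%:E)%E.
  (* Here A (n) - A (n + 1) = 2 / (n^2 - 1/4). *)
  pose A (n : nat) : R := 4 / (2 * n%:R - 1).
  rewrite (_ : 21 / 2 = r 0 + 2 * A 1%N); last by rewrite /r /A eqxx; field.
  apply: esum_even_telescope_le => [m|n|m m0].
  - rewrite /r; case: eqP => [_|/eqP /m1 h]; first lra.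
    by rewrite divr_ge0//; lra.
  - by rewrite /A divr_ge0// -natr1; have := ler0n R n; lra.
  rewrite /r (negbTE m0) /A -real_normK ?num_real// -intr_norm -abszE -pmulrn.
  rewrite -[(`|m|.+1)%N]addn1 natrD.
  have : 1 <= `|m|%:R :> R by rewrite ler1n absz_gt0.
  move: (`|m|%N%:R) => x x1.
  rewrite -subr_ge0.
  have -> : 4 / (2 * x - 1) - 4 / (2 * (x + 1) - 1) - 2 / (x ^+ 2 - 12^-1) =
     4 / (3 * (2 * x - 1) * (2 * (x + 1) - 1) * (x ^+ 2 - 12^-1)).
    by field; rewrite !gt_eqF//; nra.
  by rewrite divr_ge0// !mulr_ge0//; nra.
apply: le_trans rE; apply: le_trans (esum_rows_le _ _ _ a0 ar).
rewrite /lattice_sum esum_mkcond; apply: le_esum => -[m n] _.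
have -> : ((m, n) \in Z2_0) = ((m, n) != (0, 0)).
  by apply/idP/idP => [/set_mem|mn0]; [|exact/mem_set].
rewrite /a /=; case: eqP => //= /eqP mn0; rewrite lee_fin /normsq /= intrD !rmorphXn /=.
have N0 : 0 < m%:~R ^+ 2 + n%:~R ^+ 2 :> R.
  have [m0|/m1 h] := eqVneq m 0; last by have := sqr_ge0 (n%:~R : R); lra.
  have n0 : n != 0 by apply: contraNneq mn0 => ->; rewrite m0.
  by have := m1 n n0; have := sqr_ge0 (m%:~R : R); lra.
have mu2 := sqr_ge0 mu.
rewrite lef_pV2 ?posrE ?powR_gt0//; last by lra.
by rewrite ge0_ler_powR ?nnegrE; lra.
Qed.


Lemma scaled_bound_lt (R : realType) (c mu : R) : 0 < c -> 0 < mu ->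
    mu ^+ 2 = c ^+ 2 + 6^-1 -> 3^-1 <= mu ^+ 2 ->
  mu * (2 * pi / c - (mu ^+ 3)^-1) < 2 * pi.
Proof.
move=> c0 mu0 muE mu3.
(* mu^2 >= 1/3 gives c^2 >= mu^2 / 2. *)
have cmu : 7 / 10 * mu <= c by nra.
(* Since mu^2 - c^2 = 1/6, the claim amounts to pi mu^2 < 3 c (mu + c), and
   c >= 7/10 mu makes the right-hand side at least 3.57 mu^2. *)
have key : pi * mu ^+ 2 < 3 * c * (mu + c).
  have : pi * mu ^+ 2 <= 10 / 3 * mu ^+ 2.
    by rewrite ler_pM2r ?exprn_gt0// pi_le_10_3.
  nra.
rewrite -subr_gt0.
have -> : 2 * pi - mu * (2 * pi / c - (mu ^+ 3)^-1) =
   (3 * c * (mu + c) - pi * mu ^+ 2 * (6 * (mu ^+ 2 - c ^+ 2)))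
   / (3 * c * mu ^+ 2 * (mu + c)).
  by field; rewrite !gt_eqF//= addr_gt0.
rewrite muE addrAC subrr add0r divff// mulr1 -muE.
by rewrite divr_gt0 ?subr_gt0// !mulr_gt0 ?exprn_gt0 ?addr_gt0.
Qed.

Local Open Scope ereal_scope.

(* The first conjunct (convergence) is implicit in writing the series; it has
   content only at mu = 0, where 0 * +oo = 0 in the extended reals. *)
Theorem proposition4p2 (R : realType) (k mu : R) (hk : k = (3 / 2)%R)
    (hmu : (0 <= mu)%R) :
  lattice_sum k mu < +oo /\
  (mu `^ (2 * k - 2))%:E * lattice_sum k mu < (pi / (k - 1))%:E.
Proof.
rewrite {k}hk; split; first exact: le_lt_trans (lattice_sum_le _ _) (ltry _).
rewrite (_ : 2 * (3 / 2) - 2 = 1)%R; last by field.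
rewrite (_ : pi / (3 / 2 - 1) = 2 * pi)%R; last by field.
rewrite powRr1//.
have [mu3|mu3] := ltP (mu ^+ 2)%R 3^-1%R.
  apply: le_lt_trans (lee_wpmul2l _ (lattice_sum_le _ mu)) _; first by rewrite lee_fin.
  rewrite -EFinM lte_fin; have := pi_gt31 R; nra.
have mu0 : (0 < mu)%R
  by rewrite lt_neqAle hmu andbT; apply: contraTneq mu3 => <-; rewrite expr0n /=; lra.
pose c := Num.sqrt (mu ^+ 2 - 6^-1).
have c0 : (0 < c)%R by rewrite sqrtr_gt0; lra.
have muE : (mu ^+ 2 = c ^+ 2 + 6^-1)%R by rewrite sqr_sqrtr ?subrK//; lra.
apply: le_lt_trans (lee_wpmul2l _ (@lattice_sum_le_subr _ _ _ c0 mu0 muE)) _.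
  by rewrite lee_fin.
by rewrite -EFinM lte_fin scaled_bound_lt.
Qed.
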